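(* For each fixed $\rho>0$, the function $\sigma\mapsto v(\sigma,\rho)$ is a monotonically increasing, continuous, and concave function of $\sigma\in[0,\infty)$, and its range is $\left[\log 2\sqrt{\rho},\ \tfrac12\log 2\pi e\rho\right)$.
   Context: Logarithms are natural. For $\sigma\ge0$, $\rho>0$: $\mathcal S_n(\sigma,\rho)=\{x^n\in\mathbb R^n:\ \sum_{j=k+1}^{l}x_j^2\le \sigma+(l-k)\rho\ \text{ for all } 0\le k<l\le n\}$, and $v(\sigma,\rho):=\lim_{n\to\infty}\frac1n\log \mathrm{Vol}(\mathcal S_n(\sigma,\rho))$ (the limit exists), where $\mathrm{Vol}$ is $n$-dimensional Lebesgue measure. *)

(* Defs.v *)
From HB Require Import structures.
From mathcomp Require Import all_boot all_order all_algebra.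
From mathcomp Require Import all_classical all_reals all_analysis.

Set Implicit Arguments.
Unset Strict Implicit.
Unset Printing Implicit Defensive.

Import Order.TTheory GRing.Theory Num.Theory.
Import numFieldNormedType.Exports.

Local Open Scope classical_set_scope.
Local Open Scope ring_scope.

(* [measurableTypeR R] is [R] with its Borel sigma-algebra; tuples over it then
   carry the product, that is the Borel, sigma-algebra of R^n. *)
Notation Rn R n := (n.-tuple (measurableTypeR R)).

Section cons.
Context {R : realType} (n : nat).

Definition consRn (p : measurableTypeR R * Rn R n) : Rn R n.+1 :=
  [tuple of p.1 :: p.2].

Lemma measurable_consRn : measurable_fun setT consRn.
Proof. exact: measurable_cons. Qed.

Lemma measurable_box (F : 'I_n -> set (measurableTypeR R)) :
  (forall i, measurable (F i)) ->
  measurable [set x : Rn R n | forall i, F i (tnth x i)].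
Proof.
move=> mF; pose G (i : 'I_n) := (fun x : Rn R n => tnth x i) @^-1` (F i).
rewrite (_ : [set x | _] = \bigcap_(i in [set: 'I_n]) G i); last first.
  by apply/seteqP; split => [x Fx i _|x Fx i]; exact: Fx.
apply: fin_bigcap_measurable => // i _.
by rewrite -[G i]setTI; exact: measurable_tnth.
Qed.

End cons.

(* The n-fold product of the Lebesgue measure of R, transported along the
   identification of R * R^n with R^(n+1); on R^0 it is the unit point mass.
   [Vol_box] below characterizes it as n-dimensional Lebesgue measure. *)
Fixpoint Vol {R : realType} (n : nat) : set (Rn R n) -> \bar R :=
  match n with
  | 0 => dirac [tuple]
  | m.+1 => pushforward (@lebesgue_measure R \x @Vol R m)%E (@consRn R m)
  end.
Arguments Vol {R} n _.

Section Vol_step.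
Context {R : realType} (n : nat).
Variable mu : {sigma_finite_measure set (Rn R n) -> \bar R}.
Hypothesis mu_box : forall F : 'I_n -> set (measurableTypeR R),
  (forall i, measurable (F i)) ->
  (mu [set x | forall i, F i (tnth x i)] =
   \prod_(i < n) lebesgue_measure (F i))%E.

Let nu : set (Rn R n.+1) -> \bar R :=
  pushforward (@lebesgue_measure R \x mu)%E (@consRn R n).

Let nu_measure : {measure set (Rn R n.+1) -> \bar R}.
Proof.
pose m : {measure set (Rn R n.+1) -> \bar R} :=
  pushforward (@lebesgue_measure R \x mu)%E (@consRn R n).
exact: m (@measurable_consRn R n).
Defined.

HB.instance Definition _ := Measure.copy nu nu_measure.

Let nu_box (F : 'I_n.+1 -> set (measurableTypeR R)) :
  (forall i, measurable (F i)) ->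
  (nu [set x | forall i, F i (tnth x i)] =
   \prod_(i < n.+1) lebesgue_measure (F i))%E.
Proof.
move=> mF; have mFS i : measurable (F (lift ord0 i)) by exact: mF.
rewrite big_ord_recl -(mu_box mFS).
rewrite -(product_measure1E _ _ (mF _) (measurable_box mFS)).
rewrite /nu /pushforward.
congr (product_measure1 _ _ _); apply/seteqP; split => -[x t]/= Fx.
  split => /=; first exact: (Fx ord0).
  by move=> i; rewrite -(tnthS x t i); exact: Fx.
move=> i; case: (unliftP ord0 i) => [j ->|->]; last exact: Fx.1.
by rewrite tnthS; exact: Fx.2.
Qed.

Let nu_sigma_finite : sigma_finite setT nu.
Proof.
pose I k : set (measurableTypeR R) := `[- k%:R, k%:R]%classic.
have mI k : measurable (I k) by exact: measurable_itv.
exists (fun k => [set x | forall i, I k (tnth x i)]) => [|k].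
  apply/esym/seteqP; split => // x _.
  exists (Num.truncn (\sum_i `|tnth x i|)).+1 => //= i.
  rewrite /I/= in_itv/= -ler_norml.
  apply: (@le_trans _ _ (\sum_i `|tnth x i|)).
    by rewrite (bigD1 i)//= lerDl sumr_ge0.
  exact/ltW/truncnS_gt.
split; first exact: (@measurable_box R n.+1 (fun=> I k)).
rewrite (nu_box (F := fun=> I k))// ltey_eq prode_fin_num// => i _.
by rewrite /I lebesgue_measure_itv/=; case: ifP.
Qed.

HB.instance Definition _ := Measure_isSigmaFinite.Build _ _ _ nu nu_sigma_finite.

Lemma Vol_step : exists2 nu : {sigma_finite_measure set (Rn R n.+1) -> \bar R},
    nu = pushforward (@lebesgue_measure R \x mu)%E (@consRn R n) :> (set _ -> _)
  & forall F : 'I_n.+1 -> set (measurableTypeR R), (forall i, measurable (F i)) ->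
    (nu [set x | forall i, F i (tnth x i)] =
     \prod_(i < n.+1) lebesgue_measure (F i))%E.
Proof. by exists nu. Qed.

End Vol_step.

Section Vol_measure.
Context {R : realType} (n : nat).

Let Vol_measureP :
  exists2 mu : {sigma_finite_measure set (Rn R n) -> \bar R},
    mu = Vol n :> (set _ -> _) & forall F : 'I_n -> set (measurableTypeR R),
      (forall i, measurable (F i)) ->
      (mu [set x | forall i, F i (tnth x i)] =
       \prod_(i < n) lebesgue_measure (F i))%E.
Proof.
elim: n => [|m [mu Vmu mu_box]].
  exists (dirac ([tuple] : Rn R 0)) => // F mF.
  by rewrite big_ord0/= /dirac/= indicE mem_set// => -[].
by have [nu Enu nu_box] := Vol_step mu_box; exists nu => //=; rewrite Enu Vmu.
Qed.

Let Vol0 : @Vol R n set0 = 0%E.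
Proof. by have [mu <- _] := Vol_measureP; exact: measure0. Qed.

Let Vol_ge0 A : (0 <= @Vol R n A)%E.
Proof. by have [mu <- _] := Vol_measureP; exact: measure_ge0. Qed.

Let Vol_semi_sigma_additive : semi_sigma_additive (@Vol R n).
Proof.
by have [mu <- _] := Vol_measureP; exact: measure_semi_sigma_additive.
Qed.

HB.instance Definition _ := isMeasure.Build _ _ _ (@Vol R n)
  Vol0 Vol_ge0 Vol_semi_sigma_additive.

Let Vol_sigma_finite : sigma_finite setT (@Vol R n).
Proof. by have [mu <- _] := Vol_measureP; exact: sigma_finiteT. Qed.

HB.instance Definition _ :=
  Measure_isSigmaFinite.Build _ _ _ (@Vol R n) Vol_sigma_finite.

Lemma Vol_box (F : 'I_n -> set (measurableTypeR R)) :
  (forall i, measurable (F i)) ->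
  (Vol n [set x | forall i, F i (tnth x i)] =
   \prod_(i < n) lebesgue_measure (F i))%E.
Proof. by have [mu <- mu_box] := Vol_measureP; exact: mu_box. Qed.

End Vol_measure.

Section power_constraint.
Context {R : realType}.
Implicit Types sigma rho : R.

(* Coordinates are numbered from 0, so x_(k+1), ..., x_l are the [tnth x i] with
   k <= i < l. *)
Definition calS n sigma rho : set (Rn R n) :=
  [set x | forall k l : nat, (k < l <= n)%N ->
    \sum_(i < n | (k <= i < l)%N) (tnth x i : R) ^+ 2
      <= sigma + (l - k)%:R * rho].

(* For sigma >= 0 and rho > 0 the set is bounded and contains a nondegenerate
   cube, so its volume is finite and positive: the default values of [fine] and
   [ln] are not met. *)
Definition v_seq sigma rho (n : nat) : R :=
  n%:R^-1 * ln (fine (Vol n (@calS n sigma rho))).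

Definition v sigma rho : R := limn (v_seq sigma rho).

Definition concave_function (D : set R) (f : R -> R) : Prop :=
  convex_function (E := R^o) D (fun x => - f x).

End power_constraint.
Arguments calS {R} n sigma rho.

(* Main.v *)
Require Import Defs.
From mathcomp Require Import all_boot all_order all_algebra.
From mathcomp Require Import all_classical all_reals all_analysis.
From mathcomp Require Import measurable_realfun ring lra.
Import Order.TTheory GRing.Theory Num.Theory.
Import numFieldNormedType.Exports.
Local Open Scope classical_set_scope.
Local Open Scope ring_scope.

(* Volumes are computed one coordinate at a time: the volume of [calS n] is the
   n-th iterate of an integral operator in one variable, the level s of a battery
   of capacity sigma.  The iterates are submultiplicative, so v exists by Fekete's
   lemma.  They are log-concave jointly in (s, sigma), by induction: the next level
   min(sigma, s) + rho - x^2 is jointly concave in (s, sigma, x), and x is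
   integrated out with the one-dimensional Prekopa-Leindler inequality, needed only
   for even unimodal functions.  Hence v is concave.
   The bound x^2 <= sigma + rho gives v <= log 2 sqrt(sigma + rho), hence v(0) and
   continuity at 0.  Bounding an indicator by the Gaussian weight
   exp((s - x^2) / (2 rho)), integrated over the bounded range of x only, gives
   v < (1/2) log(2 pi e rho).  Conversely under this weight the level is a
   martingale, which survives about sigma^2 steps in [0, sigma], whereas recharging
   the battery costs only O(sigma) steps: so v tends to this bound as sigma grows.
   Strict monotonicity follows from concavity since the bound is not attained. *)

(** * Integrals of functions with bounded support, and the battery recursion *)

Section bounded_support.
Context {R : realType}.
Local Notation mu := (@lebesgue_measure R).
Implicit Types (f g : R -> R) (D : set R) (a M c : R).

Lemma sqr_le_itv a (x : R) : 0 <= a -> (x ^+ 2 <= a ^+ 2) = (x \in `[- a, a]).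
Proof.
by move=> a0; rewrite in_itv/= -ler_norml -[in LHS]real_normK ?num_real// ler_sqr.
Qed.

Lemma integrable_restrict f D : measurable D ->
  mu.-integrable D (EFin \o f) -> mu.-integrable setT (EFin \o f \_ D).
Proof.
by move=> mD /(@integrable_mkcond _ _ R mu _ _ mD); rewrite restrict_EFin.
Qed.

Lemma integrable_mulr f c :
  mu.-integrable setT (EFin \o f) -> mu.-integrable setT (EFin \o (fun x => f x * c)).
Proof.
by move=> intf; apply: eq_integrable (@integrableZr _ _ _ mu _ measurableT c _ intf).
Qed.

Lemma integrable_mull D f c : measurable D ->
  mu.-integrable D (EFin \o f) -> mu.-integrable D (EFin \o (fun x => c * f x)).
Proof.
by move=> mD intf; apply: eq_integrable (@integrableZl _ _ _ mu _ mD c _ intf).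
Qed.

Lemma le_Rintegral_subset f g D : measurable D ->
  mu.-integrable setT (EFin \o f) -> mu.-integrable D (EFin \o g) ->
  (forall x, D x -> f x <= g x) -> (forall x, ~ D x -> f x <= 0) ->
  \int[mu]_x f x <= \int[mu]_(x in D) g x.
Proof.
move=> mD intf intg fg f0; rewrite [leRHS]Rintegral_mkcond.
apply: le_Rintegral => //; first exact: integrable_restrict.
move=> x _; rewrite patchE; case: ifPn => [/set_mem/fg//|].
by move=> /negP xD; apply: f0 => Dx; apply: xD; exact/mem_set.
Qed.

Lemma ge_Rintegral_subset f g D : measurable D ->
  mu.-integrable setT (EFin \o f) -> mu.-integrable D (EFin \o g) ->
  (forall x, D x -> g x <= f x) -> (forall x, 0 <= f x) ->
  \int[mu]_(x in D) g x <= \int[mu]_x f x.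
Proof.
move=> mD intf intg gf f0; rewrite [leLHS]Rintegral_mkcond.
apply: le_Rintegral => //; first exact: integrable_restrict.
by move=> x _; rewrite patchE; case: ifPn => [/set_mem/gf|].
Qed.

Lemma integrable_cst_itv a c : mu.-integrable `[- a, a] (EFin \o cst c).
Proof.
apply: measurable_bounded_integrable => //=; last exact: bounded_cst.
by rewrite lebesgue_measure_itv/=; case: ifPn => // _; rewrite -EFinB ltry.
Qed.

Lemma Rintegral_cst_itv a c : 0 <= a ->
  \int[mu]_(x in `[- a, a]) c = c * (2 * a).
Proof.
move=> a0; rewrite Rintegral_cst//= lebesgue_measure_itv/= lte_fin.
have [aa|aa] := ltP (- a) a; first by rewrite -EFinB/= opprK mulr_natl mulr2n.
by rewrite (_ : a = 0) ?mulr0//; lra.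
Qed.

Lemma integrable_bounded_support f a M : measurable_fun setT f ->
  (forall x, 0 <= f x <= M) -> (forall x, x \notin `[- a, a] -> f x = 0) ->
  mu.-integrable setT (EFin \o f).
Proof.
move=> mf fM f0.
have -> : f = f \_ `[- a, a].
  by apply/funext => x; rewrite patchE mem_setE; case: ifPn => //= /f0.
apply: integrable_restrict => //.
apply: measurable_bounded_integrable => //.
- by rewrite /= lebesgue_measure_itv/=; case: ifPn => // _; rewrite -EFinB ltry.
- exact: measurable_funTS.
- exists M; split; rewrite ?num_real// => y My x _ /=.
  have /andP[fx0 fxM] := fM x.
  by rewrite ger0_norm//; exact: le_trans fxM (ltW My).
Qed.

Lemma Rintegral_le_cst_support f a M : 0 <= a ->
  mu.-integrable setT (EFin \o f) ->
  (forall x, x \in `[- a, a] -> f x <= M) ->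
  (forall x, x \notin `[- a, a] -> f x <= 0) ->
  \int[mu]_x f x <= M * (2 * a).
Proof.
move=> a0 intf fM f0; rewrite -Rintegral_cst_itv//.
by apply: le_Rintegral_subset => //; [exact: integrable_cst_itv|move=> x /negP/f0].
Qed.

Lemma Rintegral_ge_cst_itv f a c : 0 <= a ->
  mu.-integrable setT (EFin \o f) -> (forall x, 0 <= f x) ->
  (forall x, x \in `[- a, a] -> c <= f x) -> c * (2 * a) <= \int[mu]_x f x.
Proof.
move=> a0 intf f0 fc; rewrite -Rintegral_cst_itv//.
by apply: ge_Rintegral_subset => //; exact: integrable_cst_itv.
Qed.

End bounded_support.

(* Read a point x of [calS n sigma rho] as a sequence of withdrawals from a
   battery of capacity sigma, recharged by rho at each step: the level s becomes
   min(sigma, s) + rho - x_1^2, and must stay nonnegative. [batteryVol n s] is the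
   volume of the set of the withdrawals of length n feasible from the level s. *)
Fixpoint batteryVol {R : realType} (sigma rho : R) (n : nat) (s : R) : R :=
  (0 <= s)%R%:R * match n with
  | 0 => 1
  | m.+1 => \int[@lebesgue_measure R]_x
      batteryVol sigma rho m (Num.min sigma s + rho - x ^+ 2)
  end.

Section batteryVol.
Context {R : realType} (sigma rho : R).
Hypotheses (sigma_ge0 : 0 <= sigma) (rho_gt0 : 0 < rho).
Local Notation mu := (@lebesgue_measure R).
Local Notation W := (batteryVol sigma rho).
Local Notation amax := (Num.sqrt (sigma + rho)).

Let sr_gt0 : 0 < sigma + rho. Proof. by rewrite ltr_wpDl. Qed.

Lemma batteryVol_neg n s : s < 0 -> W n s = 0.
Proof. by move=> s0; case: n => [|n] /=; rewrite leNgt s0 mul0r. Qed.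

Lemma batteryVolS n s : 0 <= s ->
  W n.+1 s = \int[mu]_x W n (Num.min sigma s + rho - x ^+ 2).
Proof. by move=> s0 /=; rewrite s0 mul1r. Qed.

(** Before a withdrawal the level is at most [sigma + rho], so a larger x^2 makes it negative. *)
Lemma batteryVol_support n s x : x \notin `[- amax, amax] ->
  W n (Num.min sigma s + rho - x ^+ 2) = 0.
Proof.
rewrite -sqr_le_itv ?sqrtr_ge0// sqr_sqrtr ?(ltW sr_gt0)// -ltNge => sx.
apply: batteryVol_neg; rewrite subr_lt0; apply: le_lt_trans sx.
by rewrite lerD2r ge_min lexx.
Qed.

Let nd_integrable n (C : R) s : {homo W n : x y / x <= y} ->
  (forall s, 0 <= W n s <= C) ->
  mu.-integrable setT (fun x => (W n (Num.min sigma s + rho - x ^+ 2))%:E).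
Proof.
move=> ndW WC; set f := fun x => W n (Num.min sigma s + rho - x ^+ 2).
apply: (@integrable_bounded_support _ f amax C).
- apply: (@measurableT_comp _ _ _ _ _ _ (W n)).
    exact: nondecreasing_measurable.
  by apply: measurable_funB => //; exact: measurable_funX.
- by move=> x; exact: WC.
- by move=> x; exact: batteryVol_support.
Qed.

(** Both facts are proved in one induction: integrability of the next integrand needs monotonicity
    for measurability and the bound for finiteness. *)
Let batteryVol_nd_bounded n : {homo W n : x y / x <= y} /\
  forall s, 0 <= W n s <= (2 * amax) ^+ n.
Proof.
elim: n => [|n [ndW WC]]; first split => [x y xy|s] /=.
- by rewrite !mulr1 ler_nat; case: (leP 0 x) => // x0; rewrite (le_trans x0).
- by rewrite expr0 mulr1; case: (leP 0 s); rewrite ?ler01 ?lexx.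
have int0 s : 0 <= \int[mu]_x W n (Num.min sigma s + rho - x ^+ 2).
  by apply: Rintegral_ge0 => x _; have /andP[] := WC (Num.min sigma s + rho - x ^+ 2).
split=> [x y xy|s].
  have [x0|x0] := ltP x 0.
    by rewrite (batteryVol_neg n.+1 _ x0)/=; apply: mulr_ge0.
  rewrite !batteryVolS//; last exact: le_trans xy.
  apply: le_Rintegral => //; do ?exact: nd_integrable _ _ _ ndW WC.
  move=> z _; apply: ndW; rewrite lerD2r lerD2r le_min ge_min lexx/=.
  by rewrite ge_min xy orbT.
have [s0|s0] := ltP s 0.
  by rewrite batteryVol_neg// lexx/= exprn_ge0// mulr_ge0// sqrtr_ge0.
rewrite batteryVolS// int0/= exprSr.
apply: Rintegral_le_cst_support; rewrite ?sqrtr_ge0//.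
- exact: nd_integrable _ _ _ ndW WC.
- by move=> x _; have /andP[] := WC (Num.min sigma s + rho - x ^+ 2).
- by move=> x xs; rewrite batteryVol_support.
Qed.

Lemma batteryVol_homo n : {homo W n : x y / x <= y}.
Proof. by have [] := batteryVol_nd_bounded n. Qed.

Lemma batteryVol_ge0 n s : 0 <= W n s.
Proof. by have [_ /(_ s)/andP[]] := batteryVol_nd_bounded n. Qed.

Lemma batteryVol_le_pow n s : W n s <= (2 * amax) ^+ n.
Proof. by have [_ /(_ s)/andP[]] := batteryVol_nd_bounded n. Qed.

Lemma batteryVol_integrable n s :
  mu.-integrable setT (EFin \o (fun x => W n (Num.min sigma s + rho - x ^+ 2))).
Proof.
have [ndW WC] := batteryVol_nd_bounded n; exact: nd_integrable _ _ _ ndW WC.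
Qed.

Lemma batteryVol_min n s : W n (Num.min sigma s) = W n s.
Proof.
have [s0|s0] := ltP s 0.
  by rewrite !batteryVol_neg// gt_min s0 orbT.
have ms0 : 0 <= Num.min sigma s by rewrite le_min sigma_ge0.
case: n => [|n]; first by rewrite /= s0 ms0.
by rewrite !batteryVolS// minA minxx.
Qed.

Lemma batteryVol_le_cap n s : W n s <= W n sigma.
Proof. by rewrite -batteryVol_min; apply: batteryVol_homo; rewrite ge_min lexx. Qed.

(** A withdrawal with x^2 <= [rho] never exceeds the recharge, so a whole cube is feasible from any
    nonnegative level. *)
Lemma batteryVol_ge_pow n s : 0 <= s -> (2 * Num.sqrt rho) ^+ n <= W n s.
Proof.
elim: n s => [|n IH] s s0; first by rewrite /= s0 mulr1.
rewrite batteryVolS// exprSr; apply: Rintegral_ge_cst_itv; rewrite ?sqrtr_ge0//.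
- exact: batteryVol_integrable.
- by move=> x; exact: batteryVol_ge0.
move=> x; rewrite -sqr_le_itv ?sqrtr_ge0// sqr_sqrtr ?(ltW rho_gt0)// => xr.
apply: IH; rewrite -addrA addr_ge0 ?subr_ge0// le_min sigma_ge0//.
Qed.

Lemma batteryVol_gt0 n s : 0 <= s -> 0 < W n s.
Proof.
move=> /(batteryVol_ge_pow n); apply: lt_le_trans.
by rewrite exprn_gt0// mulr_gt0// sqrtr_gt0.
Qed.

(** Whatever level remains after m steps, a full battery does at least as well. *)
Lemma batteryVol_submul m n s : W (m + n) s <= W m s * W n sigma.
Proof.
elim: m s => [|m IH] s.
  have [s0|s0] := ltP s 0.
    by rewrite !(batteryVol_neg _ _ s0) mul0r.
  by rewrite /= s0 !mul1r; exact: batteryVol_le_cap.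
have [s0|s0] := ltP s 0; first by rewrite addSn !(batteryVol_neg _ _ s0) mul0r.
rewrite addSn !batteryVolS// -RintegralZr//; last exact: batteryVol_integrable.
apply: le_Rintegral => //; first exact: batteryVol_integrable.
exact/integrable_mulr/batteryVol_integrable.
Qed.

(** After m feasible steps the level is at least 0, and [W n] is nondecreasing. *)
Lemma batteryVol_supmul m n s : W m s * W n 0 <= W (m + n) s.
Proof.
elim: m s => [|m IH] s.
  have [s0|s0] := ltP s 0; first by rewrite !(batteryVol_neg _ _ s0) mul0r.
  by rewrite /= s0 !mul1r; exact: batteryVol_homo.
have [s0|s0] := ltP s 0; first by rewrite addSn !(batteryVol_neg _ _ s0) mul0r.
rewrite addSn !batteryVolS// -RintegralZr//; last exact: batteryVol_integrable.
apply: le_Rintegral => //; last exact: batteryVol_integrable.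
exact/integrable_mulr/batteryVol_integrable.
Qed.

(* Restrict the first m withdrawals to x^2 <= rho / 2: each raises the level by at
   least rho / 2, up to saturation. *)
Lemma batteryVol_recharge m n s : 0 <= s ->
  (2 * Num.sqrt (rho / 2)) ^+ m * W n (Num.min sigma (s + m%:R * (rho / 2)))
    <= W (m + n) s.
Proof.
elim: m s => [|m IH] s s0.
  by rewrite expr0 mul1r mul0r addr0 batteryVol_min.
have r20 : 0 <= rho / 2 by rewrite divr_ge0// ltW.
rewrite addSn !batteryVolS// exprSr mulrAC.
apply: Rintegral_ge_cst_itv; rewrite ?sqrtr_ge0//.
- exact: batteryVol_integrable.
- by move=> x; exact: batteryVol_ge0.
move=> x; rewrite -sqr_le_itv ?sqrtr_ge0// sqr_sqrtr// => xr.
have ms0 : 0 <= Num.min sigma s by rewrite le_min sigma_ge0.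
apply: (@le_trans _ _ (W (m + n) (Num.min sigma s + rho / 2))); last first.
  by apply: batteryVol_homo; lra.
apply: le_trans (IH _ _); last by rewrite addr_ge0.
rewrite ler_wpM2l ?exprn_ge0// ?mulr_ge0 ?sqrtr_ge0//; apply: batteryVol_homo.
have mr0 : 0 <= m%:R * (rho / 2) by rewrite mulr_ge0.
rewrite -natr1; case: (leP sigma s) => ss; rewrite le_min ge_min lexx/=.
  by rewrite ge_min; apply/orP; left; lra.
by rewrite ge_min; apply/orP; right; lra.
Qed.

End batteryVol.

(** * Volumes of the constraint sets, and Fekete's lemma *)

Section feasible.
Context {R : realType} (sigma rho : R).
Hypotheses (sigma_ge0 : 0 <= sigma) (rho_gt0 : 0 < rho).
Local Notation mu := (@lebesgue_measure R).
Local Notation W := (batteryVol sigma rho).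

(** The level after l steps is the least of s + l rho and of sigma + (l - k) rho for k < l, each
    less the withdrawals made since step 0, respectively k. The prefixes thus encode the initial
    level, the windows of [calS] the saturation. *)
Definition feasible n (s : R) : set (Rn R n) :=
  [set x | calS n sigma rho x /\ forall l, (l <= n)%N ->
    \sum_(i < n | (i < l)%N) (tnth x i : R) ^+ 2 <= s + l%:R * rho].

Lemma feasible_cap n : feasible n sigma = calS n sigma rho.
Proof.
apply/seteqP; split=> [x [//]|x Sx]; split=> // -[|l] ln.
  by rewrite big_pred0// mul0r addr0.
by have := Sx 0%N l.+1; rewrite subn0; apply.
Qed.

Lemma feasible_neg n s : s < 0 -> feasible n s = set0.
Proof.
move=> s0; apply/seteqP; split=> // x [_ /(_ 0%N)].
by rewrite big_pred0// mul0r addr0 leNgt s0 => /(_ isT).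
Qed.

Lemma feasible_cons n s (x : R) (t : Rn R n) : 0 <= s <= sigma ->
  feasible n.+1 s (consRn (x, t)) <->
  feasible n (Num.min sigma (s + rho - x ^+ 2)) t.
Proof.
move=> /andP[s0 ss].
have sumS k l : \sum_(i < n.+1 | (k.+1 <= i < l.+1)%N)
    (tnth (consRn (x, t)) i : R) ^+ 2 =
    \sum_(i < n | (k <= i < l)%N) (tnth t i : R) ^+ 2.
  by rewrite big_mkcond big_ord_recl/= add0r -big_mkcond/=;
     under eq_bigr do rewrite tnthS.
have sum0 l : \sum_(i < n.+1 | (i < l.+1)%N) (tnth (consRn (x, t)) i : R) ^+ 2 =
    x ^+ 2 + \sum_(i < n | (i < l)%N) (tnth t i : R) ^+ 2.
  by rewrite big_mkcond big_ord_recl/= -big_mkcond/=;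
     under eq_bigr do rewrite tnthS.
split=> -[St Pt].
  split=> [k l kl|l ln].
    by have := St k.+1 l.+1; rewrite sumS subSS; exact.
  have := Pt l.+1; rewrite sum0 -natr1 mulrDl mul1r => /(_ ln) Pl.
  rewrite addr_minl le_min; apply/andP; split; last lra.
  (* The cap [sigma] on the next level is the window starting at the second coordinate. *)
  case: l => [|l] in ln Pl *; first by rewrite big_pred0// mul0r addr0.
  by have := St 1%N l.+2; rewrite sumS subSS subn0; apply.
have P0 l : (l <= n)%N ->
    x ^+ 2 + \sum_(i < n | (i < l)%N) (tnth t i : R) ^+ 2 <= s + l.+1%:R * rho.
  by move=> /Pt; rewrite addr_minl le_min -natr1 mulrDl mul1r => /andP[_]; lra.
split=> [[|k] [|l]//|[|l]] ln.
(* Windows starting at the first coordinate follow from the prefix bounds because [s <= sigma]. *)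
- by rewrite subn0 sum0; apply: le_trans (P0 _ _) _ => //; rewrite lerD2r.
- by rewrite sumS subSS; exact: St.
- by rewrite big_pred0// mul0r addr0.
- by rewrite sum0; exact: P0.
Qed.

Lemma Vol_feasible n s : s <= sigma -> Vol n (feasible n s) = (W n s)%:E.
Proof.
have [s0|s0] := ltP s 0.
  by rewrite feasible_neg// measure0 batteryVol_neg.
elim: n s s0 => [|n IH] s s0 ss.
  rewrite /= s0 mul1r diracE mem_set//; split=> [k l|l] ln.
    by rewrite big_ord0 addr_ge0// mulr_ge0// ltW.
  by rewrite big_ord0 addr_ge0// mulr_ge0// ltW.
rewrite batteryVolS// fineK; last first.
  by apply: integrable_fin_num => //; exact: batteryVol_integrable.
rewrite /= /pushforward /product_measure1; apply: eq_integral => x _ /=.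
rewrite min_r//.
have -> : xsection (consRn (n := n) @^-1` feasible n.+1 s) x =
    feasible n (Num.min sigma (s + rho - x ^+ 2)).
  apply/seteqP; split=> t; rewrite /xsection/= inE/=.
    by move=> /feasible_cons; apply; rewrite s0.
  by move=> ft; apply/feasible_cons; rewrite ?s0.
(* Capping the level brings it under [sigma], as [IH] demands. *)
rewrite -batteryVol_min//.
have [r0|r0] := ltP (Num.min sigma (s + rho - x ^+ 2)) 0.
  by rewrite feasible_neg// measure0 batteryVol_neg.
by apply: IH => //; rewrite ge_min lexx.
Qed.

Lemma v_seqE n : v_seq sigma rho n = ln (W n sigma) / n%:R.
Proof. by rewrite /v_seq -feasible_cap Vol_feasible//= mulrC. Qed.

End feasible.

Section fekete.
Context {R : realType} (a : nat -> R) (b : R).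
Hypotheses (suba : forall m n, a (m + n)%N <= a m + a n).
Hypothesis (b_le : forall n, n%:R * b <= a n).

Let A := [set a n.+1 / n.+1%:R | n in [set: nat]].

Let has_infA : has_inf A.
Proof.
split; first by exists (a 1%N / 1); exists 0%N.
by exists b => _ [n _ <-]; rewrite ler_pdivlMr// mulrC.
Qed.

Let suba_mul p q r : a (q * p + r)%N <= q%:R * a p + a r.
Proof.
elim: q => [|q IH]; first by rewrite mul0r add0r.
rewrite mulSn -addnA (le_trans (suba _ _))// -natr1 mulrDl mul1r.
by rewrite addrAC [leRHS]addrC lerD2l.
Qed.

(** Divide n by a fixed p whose quotient a p / p is nearly the infimum: the remainder costs a
    constant, negligible after division by n. *)
Lemma fekete : a n / n%:R @[n --> \oo] --> inf A.
Proof.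
apply/cvgrPdist_le => e e0; have e20 : 0 < e / 2 by rewrite divr_gt0.
have [_ [m _ <-] am] := inf_adherent e20 has_infA.
set p := m.+1 in am; have p0 : 0 < p%:R :> R by rewrite ltr0n.
(* Bounds the cost of a remainder r < p: a r <= r a 1 + a 0, and the missing term r (a p / p) is at
   most |a p| in size. *)
pose C := `|a p| + a 0%N + p%:R * `|a 1%N|.
have a0 : 0 <= a 0%N by have := b_le 0%N; rewrite mul0r.
have aC n : a n <= n%:R * (a p / p%:R) + C.
  rewrite {1}(divn_eq n p) (le_trans (suba_mul _ _ _))//.
  have := suba_mul 1%N (n %% p)%N 0%N; rewrite muln1 addn0 => ar.
  have rp : (n %% p)%:R <= p%:R :> R by rewrite ler_nat ltnW// ltn_pmod.
  have : (n %% p)%:R * a 1%N <= p%:R * `|a 1%N|.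
    by rewrite (le_trans (ler_norm _))// normrM normr_nat ler_wpM2r.
  have -> : n%:R * (a p / p%:R) =
      (n %/ p)%:R * a p + (n %% p)%:R * (a p / p%:R).
    by rewrite {1}(divn_eq n p) natrD natrM; field; rewrite pnatr_eq0.
  have : - ((n %% p)%:R * (a p / p%:R)) <= `|a p|.
    rewrite (le_trans (ler_norm _))// normrN !normrM normr_nat normfV normr_nat.
    by rewrite mulrCA ler_piMr// ler_pdivrMr// mul1r.
  rewrite /C; lra.
near=> n.
have n0 : 0 < n%:R :> R by rewrite ltr0n; near: n; exact: nbhs_infty_gt.
have An : inf A <= a n / n%:R.
  apply: ge_inf; first exact: has_infA.2.
  by exists n.-1 => //; rewrite prednK// -(ltr0n R).
rewrite distrC ger0_norm ?subr_ge0// lerBlDr.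
have Cn : C / n%:R <= e / 2.
  rewrite ler_pdivrMr// mulrC -ler_pdivrMr//.
  by near: n; exact: nbhs_infty_ger.
have : a n / n%:R <= a p / p%:R + C / n%:R.
  rewrite ler_pdivrMr// mulrDl divfK ?gt_eqF//.
  by rewrite mulrC; exact: aC.
lra.
Unshelve. all: by end_near. Qed.

End fekete.

(** * The Prekopa-Leindler inequality for even unimodal functions *)

Section prekopa_leindler.
Context {R : realType}.
Local Notation mu := (@lebesgue_measure R).
Implicit Types (f g h : R -> R) (A B C : set R) (t u : R).

(** Superlevel sets are then intervals centred at 0, and Brunn-Minkowski on the line reduces to
    adding radii. *)
Definition even_unimodal f := forall x y, `|x| <= `|y| -> f y <= f x.

(** Empty for u < 0, so that the layer-cake integral can run over the whole line. *)
Let level f u : set R := [set x | 0 <= u < f x].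

Let subgraph f : set (R * R) := [set z | 0 <= z.2 < f z.1].

Let measurable_subgraph f : measurable_fun setT f ->
  measurable (subgraph f).
Proof.
move=> mf.
pose f0 (z : R * R) := 0 <= z.2; pose f1 (z : R * R) := z.2 < f z.1.
rewrite (_ : subgraph f = f0 @^-1` [set true] `&` f1 @^-1` [set true]); last first.
  by apply/seteqP; split=> z /= /andP.
apply: measurableI.
  have : measurable_fun setT f0 by exact: measurable_fun_ler.
  by move=> /(_ measurableT [set true]); rewrite setTI; exact.
have : measurable_fun setT f1.
  by apply: measurable_fun_ltr => //; exact: measurableT_comp.
by move=> /(_ measurableT [set true]); rewrite setTI; exact.
Qed.

Let ysection_subgraph f u :
  ysection (subgraph f) u = level f u.
Proof. by apply/seteqP; split=> x; rewrite /ysection/= inE. Qed.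

Let measurable_level_measure f : measurable_fun setT f ->
  measurable_fun setT (fun u => mu (level f u)).
Proof.
move=> /measurable_subgraph mA.
have := measurable_fun_ysection mu mA; congr measurable_fun.
by apply/funext => u; rewrite /= ysection_subgraph.
Qed.

Let measurable_level_measureZ f (c : \bar R) : measurable_fun setT f ->
  measurable_fun setT (fun u => c * mu (level f u))%E.
Proof. by move=> mf; apply: measurable_funeM; exact: measurable_level_measure. Qed.

Let measurable_level f u : measurable_fun setT f -> measurable (level f u).
Proof.
move=> /measurable_subgraph mA; rewrite -ysection_subgraph.
exact: measurable_ysection.
Qed.

(** Tonelli for the indicator of the subgraph, whose sections are [0, f x[ one way and the level
    sets the other way. *)
Let layer_cake f : measurable_fun setT f -> (forall x, 0 <= f x) ->
  (\int[mu]_x (f x)%:E = \int[mu]_u mu (level f u))%E.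
Proof.
move=> mf f0; have mA := measurable_subgraph _ mf.
have := @indic_fubini_tonelli _ _ _ _ _ mu mu _ mA.
rewrite indic_fubini_tonelli_FE// indic_fubini_tonelli_GE// => E.
transitivity (\int[mu]_x (mu \o xsection (subgraph f)) x)%E.
  apply: eq_integral => x _ /=.
  rewrite (_ : xsection _ x = `[0, f x[%classic).
    rewrite lebesgue_measure_itv/= lte_fin; case: ltgtP (f0 x) => // [_ _|<- _//].
    by rewrite sube0.
  by apply/seteqP; split=> u; rewrite /xsection/= inE/= in_itv.
by rewrite E; apply: eq_integral => u _ /=; rewrite ysection_subgraph.
Qed.

Let itv_le_measure A C a c : measurable A -> measurable C -> 0 <= a ->
  A `<=` `[- a, a] -> 0 <= c -> (forall x, `|x| < c -> C x) ->
  (mu A <= (2 * a)%:E)%E /\ ((2 * c)%:E <= mu C)%E.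
Proof.
move=> mA mC a0 Aa c0 cC; split.
  rewrite (@le_trans _ _ (mu `[- a, a]))//.
    by apply: le_measure; rewrite ?inE.
  rewrite lebesgue_measure_itv/= lte_fin; case: ifPn => _; last first.
    by rewrite lee_fin mulr_ge0.
  by rewrite -EFinB opprK lee_fin; lra.
rewrite (@le_trans _ _ (mu `]- c, c[))//.
  rewrite lebesgue_measure_itv/= lte_fin; case: ifPn => cc.
    by rewrite -EFinB opprK lee_fin; lra.
  by rewrite lee_fin; lra.
apply: le_measure; rewrite ?inE//.
by move=> x /=; rewrite in_itv/= -ltr_norml; exact: cC.
Qed.

(** A and B lie within closed intervals of radii a and b and contain the open ones; C contains the
    open interval of radius t a + (1 - t) b. *)
Let measure_conv t A B C L : 0 <= t <= 1 ->
  measurable A -> measurable B -> measurable C ->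
  A 0 -> B 0 -> A `<=` `[- L, L] -> B `<=` `[- L, L] ->
  (forall x y, A y -> `|x| <= `|y| -> A x) ->
  (forall x y, B y -> `|x| <= `|y| -> B x) ->
  (forall x y, A x -> B y -> C (t * x + (1 - t) * y)) ->
  (t%:E * mu A + (1 - t)%:E * mu B <= mu C)%E.
Proof.
move=> /andP[t0 t1] mA mB mC A0 B0 AL BL symA symB ABC.
(* The alternative x = 0 serves the set reduced to the origin, of radius 0. *)
have rad (D : set R) : D 0 -> D `<=` `[- L, L] ->
    (forall x y, D y -> `|x| <= `|y| -> D x) ->
    exists d, [/\ 0 <= d, D `<=` `[- d, d] & forall x, `|x| < d \/ x = 0 -> D x].
  move=> D0 DL symD; pose S := [set `|x| | x in D].
  have hS : has_sup S.
    split; first by exists `|0 : R|; exists 0.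
    by exists L => _ [x /DL + <-]; rewrite /= in_itv/= -ler_norml.
  exists (sup S); split.
  - by rewrite -(normr0 R); apply: ub_le_sup; [exact: hS.2|exists 0].
  - move=> x Dx; rewrite /= in_itv/= -ler_norml.
    by apply: ub_le_sup; [exact: hS.2|exists x].
  - move=> x [xS|->//]; have xS0 : 0 < sup S - `|x| by rewrite subr_gt0.
    have [_ [y Dy <-] xy] := sup_adherent xS0 hS.
    by apply: (symD _ y) => //; lra.
have [a [a0 Aa aA]] := rad A A0 AL symA.
have [b [b0 Bb bB]] := rad B B0 BL symB.
pose c := t * a + (1 - t) * b.
have t10 : 0 <= 1 - t by lra.
have c0 : 0 <= c by rewrite addr_ge0// mulr_ge0.
have cC x : `|x| < c -> C x.
  move=> xc; have cp : 0 < c by exact: le_lt_trans xc.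
  (* Points of A and B at the same fraction [th] of their radii combine to x. *)
  pose th := x / c; have th1 : `|th| < 1.
    by rewrite normrM normfV (gtr0_norm cp) ltr_pdivrMr// mul1r.
  have -> : x = t * (th * a) + (1 - t) * (th * b).
    have -> : t * (th * a) + (1 - t) * (th * b) = th * c by rewrite /c; ring.
    by rewrite divfK// gt_eqF.
  have sc d : 0 <= d -> `|th * d| < d \/ th * d = 0.
    rewrite le_eqVlt => /predU1P[<-|d0]; first by rewrite mulr0; right.
    by left; rewrite normrM (gtr0_norm d0) gtr_pMl.
  by apply: ABC; [apply: aA|apply: bB]; exact: sc.
have [Aa2 cC2] := itv_le_measure _ _ _ _ mA mC a0 Aa c0 cC.
have [Bb2 _] := itv_le_measure _ _ _ _ mB mC b0 Bb c0 cC.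
apply: le_trans cC2.
rewrite (@le_trans _ _ (t%:E * (2 * a)%:E + (1 - t)%:E * (2 * b)%:E)%E)//.
  by apply: leeD; apply: lee_wpmul2l; rewrite ?lee_fin.
by rewrite -!EFinM -EFinD lee_fin /c; lra.
Qed.

Let ln_conv t (a b : R) : 0 <= t <= 1 -> 0 < a -> 0 < b ->
  t * ln a + (1 - t) * ln b <= ln (t * a + (1 - t) * b).
Proof.
move=> /andP[t0 t1] a0 b0; have := concave_ln (Itv01 t0 t1) a0 b0.
by rewrite !convRE.
Qed.

Let Rintegral_conv t f g h L : 0 <= t <= 1 ->
  measurable_fun setT f -> measurable_fun setT g ->
  (forall x, 0 <= h x) ->
  mu.-integrable setT (EFin \o f) -> mu.-integrable setT (EFin \o g) ->
  mu.-integrable setT (EFin \o h) ->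
  (forall x, 0 <= f x <= f 0) -> (forall x, 0 <= g x <= g 0) ->
  f 0 = 1 -> g 0 = 1 -> even_unimodal f -> even_unimodal g ->
  (forall x, 0 < f x -> x \in `[- L, L]) ->
  (forall x, 0 < g x -> x \in `[- L, L]) ->
  (forall x y u, 0 <= u -> u < f x -> u < g y -> u < h (t * x + (1 - t) * y)) ->
  t * (\int[mu]_x f x) + (1 - t) * (\int[mu]_x g x) <= \int[mu]_x h x.
Proof.
move=> t01 mf mg h0 intf intg inth f01 g01 f1 g1 uf ug fL gL fgh.
have mh : measurable_fun setT h by apply/measurable_EFinP; exact: measurable_int inth.
have f0 x : 0 <= f x by have /andP[] := f01 x.
have g0 x : 0 <= g x by have /andP[] := g01 x.
have /andP[t0 t1] := t01; have t10 : 0 <= 1 - t by lra.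
rewrite -lee_fin EFinD !EFinM !fineK ?integrable_fin_num//.
rewrite !layer_cake// -!ge0_integralZl//; do ?exact: measurable_level_measure.
rewrite -ge0_integralD//; do ?exact: measurable_level_measureZ;
  do ?by move=> u _; rewrite mule_ge0.
apply: ge0_le_integral => //; do ?exact: measurable_level_measure.
- by move=> u _; rewrite adde_ge0// mule_ge0.
- by apply: emeasurable_funD; exact: measurable_level_measureZ.
(* For 0 <= u < 1, the common maximum, both level sets contain 0, as [measure_conv] requires; at
   other u they are empty. *)
move=> u _; have [/andP[u0 u1]|/negP u01] := boolP (0 <= u < 1).
  apply: (@measure_conv _ _ _ _ L) => //; do ?exact: measurable_level.
  - by rewrite /level/= u0 f1.
  - by rewrite /level/= u0 g1.
  - by move=> x /andP[_ ux]; apply: fL; exact: le_lt_trans ux.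
  - by move=> x /andP[_ ux]; apply: gL; exact: le_lt_trans ux.
  - by move=> x y /andP[_ uy] xy; rewrite /level/= u0 (lt_le_trans uy)//; exact: uf.
  - by move=> x y /andP[_ uy] xy; rewrite /level/= u0 (lt_le_trans uy)//; exact: ug.
  - by move=> x y /andP[_ ux] /andP[_ uy]; rewrite /level/= u0; exact: fgh.
have lv0 k : (forall x, 0 <= k x <= k 0) -> k 0 = 1 -> level k u = set0.
  move=> k01 k1; apply/seteqP; split=> // x /andP[u0 ux]; apply: u01.
  by rewrite u0 (lt_le_trans ux)// -k1; have /andP[] := k01 x.
by rewrite (lv0 f)// (lv0 g)// !measure0 !mule0 adde0.
Qed.

(* Normalize f and g by their maxima f 0 and g 0: the superlevel sets of the
   three functions then satisfy the Brunn-Minkowski inequality on R at every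
   level below 1, and integrating over the levels gives the additive inequality,
   stronger than the multiplicative one. *)
Lemma prekopa_leindler t f g h L : 0 <= t <= 1 ->
  (forall x, 0 <= f x) -> (forall x, 0 <= g x) -> (forall x, 0 <= h x) ->
  mu.-integrable setT (EFin \o f) -> mu.-integrable setT (EFin \o g) ->
  mu.-integrable setT (EFin \o h) ->
  even_unimodal f -> even_unimodal g -> 0 < f 0 -> 0 < g 0 ->
  (forall x, 0 < f x -> x \in `[- L, L]) ->
  (forall x, 0 < g x -> x \in `[- L, L]) ->
  (forall x y, 0 < f x -> 0 < g y -> 0 < h (t * x + (1 - t) * y) /\
    t * ln (f x) + (1 - t) * ln (g y) <= ln (h (t * x + (1 - t) * y))) ->
  0 < \int[mu]_x f x -> 0 < \int[mu]_x g x ->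
  t * ln (\int[mu]_x f x) + (1 - t) * ln (\int[mu]_x g x)
    <= ln (\int[mu]_x h x).
Proof.
move=> t01 f0 g0 h0 intf intg inth uf ug F0 G0 fL gL fgh If0 Ig0.
have /andP[t0 t1] := t01; have t10 : 0 <= 1 - t by lra.
set F := f 0 in F0 *; set G := g 0 in G0 *.
(* The weighted geometric mean of the maxima is the normalization of h matching the logarithmic
   hypothesis [fgh]. *)
pose K := expR (t * ln F + (1 - t) * ln G); have K0 : 0 < K := expR_gt0 _.
have mulV k c : mu.-integrable setT (EFin \o k) ->
    \int[mu]_x (k x / c) = (\int[mu]_x k x) / c.
  by move=> ik; rewrite RintegralZr.
have : t * (\int[mu]_x (f x / F)) + (1 - t) * (\int[mu]_x (g x / G))
    <= \int[mu]_x (h x / K).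
  have mE k : mu.-integrable setT (EFin \o k) -> measurable_fun setT k.
    by move=> ik; apply/measurable_EFinP; exact: measurable_int ik.
  apply: (@Rintegral_conv _ _ _ _ L) => //; do ?exact: integrable_mulr.
  - by apply: mE; exact: integrable_mulr.
  - by apply: mE; exact: integrable_mulr.
  - by move=> x; rewrite divr_ge0// ltW.
  - move=> x; rewrite divr_ge0 ?(ltW F0)//= ler_pM2r ?invr_gt0//.
    by apply: uf; rewrite normr0.
  - move=> x; rewrite divr_ge0 ?(ltW G0)//= ler_pM2r ?invr_gt0//.
    by apply: ug; rewrite normr0.
  - by rewrite divff// gt_eqF.
  - by rewrite divff// gt_eqF.
  - by move=> x y xy; rewrite ler_pM2r ?invr_gt0//; exact: uf.
  - by move=> x y xy; rewrite ler_pM2r ?invr_gt0//; exact: ug.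
  - by move=> x; rewrite pmulr_lgt0 ?invr_gt0//; exact: fL.
  - by move=> x; rewrite pmulr_lgt0 ?invr_gt0//; exact: gL.
  move=> x y u u0 ux uy.
  have fx : 0 < f x by have := le_lt_trans u0 ux; rewrite pmulr_lgt0 ?invr_gt0.
  have gy : 0 < g y by have := le_lt_trans u0 uy; rewrite pmulr_lgt0 ?invr_gt0.
  have [hz lnh] := fgh x y fx gy.
  move: u0; rewrite le_eqVlt => /predU1P[<-|u0]; first by rewrite divr_gt0.
  rewrite -ltr_ln ?posrE ?divr_gt0// in ux; rewrite -ltr_ln ?posrE ?divr_gt0// in uy.
  rewrite -ltr_ln ?posrE ?divr_gt0//.
  move: ux uy; rewrite !ln_div ?posrE// /K expRK => ux uy.
  (* The strict inequality for f survives multiplication by t only if t > 0; for t = 0 the one for g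
     serves. *)
  have [tE|tn0] := eqVneq t 0.
    by move: lnh; rewrite tE !(mul0r, subr0, mul1r, add0r); lra.
  have tp : 0 < t by rewrite lt_def tn0.
  have : t * (ln u) < t * (ln (f x) - ln F) by rewrite ltr_pM2l.
  have : (1 - t) * (ln u) <= (1 - t) * (ln (g y) - ln G).
    by rewrite ler_wpM2l// ltW.
  by move: lnh; lra.
rewrite !mulV// => conv.
have lhs0 : 0 < t * (\int[mu]_x f x / F) + (1 - t) * (\int[mu]_x g x / G).
  have := convR_gt0 (Itv01 t0 t1) (divr_gt0 If0 F0) (divr_gt0 Ig0 G0).
  by rewrite convRE.
have Ih0 : 0 < \int[mu]_x h x.
  by have := lt_le_trans lhs0 conv; rewrite pmulr_lgt0 ?invr_gt0.
(* Concavity of the logarithm passes from the additive to the multiplicative form. *)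
have := ln_conv _ _ _ t01 (divr_gt0 If0 F0) (divr_gt0 Ig0 G0).
move: conv; rewrite -ler_ln ?posrE ?divr_gt0// !ln_div ?posrE// /K expRK.
lra.
Qed.

End prekopa_leindler.

(** * Existence and concavity of the growth rate *)

Lemma batteryVol_log_concave {R : realType} (rho t sigma1 sigma2 s1 s2 : R) n :
  0 < rho -> 0 <= t <= 1 -> 0 <= sigma1 -> 0 <= sigma2 -> 0 <= s1 -> 0 <= s2 ->
  t * ln (batteryVol sigma1 rho n s1) + (1 - t) * ln (batteryVol sigma2 rho n s2)
  <= ln (batteryVol (t * sigma1 + (1 - t) * sigma2) rho n (t * s1 + (1 - t) * s2)).
Proof.
move=> rho0 t01 sg1 sg2; have /andP[t0 t1] := t01.
have t10 : 0 <= 1 - t by lra.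
set sg := t * sigma1 + (1 - t) * sigma2.
have sg0 : 0 <= sg by rewrite addr_ge0// mulr_ge0.
elim: n s1 s2 => [|n IH] s1 s2 s10 s20; set s := t * s1 + (1 - t) * s2;
  have s0 : 0 <= s by rewrite addr_ge0// mulr_ge0.
  by rewrite /= s10 s20 s0 !mulr1 ln1 !mulr0 addr0.
have [I1 I2 I] : [/\ 0 < batteryVol sigma1 rho n.+1 s1,
    0 < batteryVol sigma2 rho n.+1 s2 & 0 < batteryVol sg rho n.+1 s].
  by split; exact: batteryVol_gt0.
move: I1 I2 I; rewrite !batteryVolS// => I1 I2 I.
pose L := Num.sqrt (sigma1 + rho) + Num.sqrt (sigma2 + rho).
have unimodal sigma c : 0 <= sigma ->
    even_unimodal (fun x => batteryVol sigma rho n (c - x ^+ 2)).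
  move=> sigma0 x y xy; apply: batteryVol_homo => //.
  by rewrite lerD2l lerN2 -(real_normK (num_real x)) -(real_normK (num_real y)) ler_sqr.
have max_gt0 sigma a : 0 <= sigma -> 0 <= a ->
    0 < batteryVol sigma rho n (Num.min sigma a + rho - 0 ^+ 2).
  move=> sigma0 a0; apply: batteryVol_gt0 => //.
  by rewrite expr0n subr0 addr_ge0 ?(ltW rho0)// le_min sigma0.
have support sigma a x : 0 <= sigma -> Num.sqrt (sigma + rho) <= L ->
    0 < batteryVol sigma rho n (Num.min sigma a + rho - x ^+ 2) -> x \in `[- L, L].
  move=> sigma0 aL; apply: contraTT => xL; rewrite batteryVol_support ?ltxx//.
  by apply: contra xL; rewrite !in_itv/=; lra.
apply: (@prekopa_leindler _ _ _ _ _ L) => //; do ?exact: batteryVol_integrable.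
- by move=> x; exact: batteryVol_ge0.
- by move=> x; exact: batteryVol_ge0.
- by move=> x; exact: batteryVol_ge0.
- exact: unimodal.
- exact: unimodal.
- exact: max_gt0.
- exact: max_gt0.
- by move=> x; apply: support => //; rewrite lerDl sqrtr_ge0.
- by move=> x; apply: support => //; rewrite lerDr sqrtr_ge0.
move=> x y; set c1 := Num.min sigma1 s1 + rho - x ^+ 2.
set c2 := Num.min sigma2 s2 + rho - y ^+ 2.
have [c10|c10] := ltP c1 0; first by rewrite batteryVol_neg// ltxx.
have [c20|c20] := ltP c2 0; first by rewrite (batteryVol_neg _ _ _ c2)// ltxx.
move=> _ _; set c := _ - _.
(* Joint concavity of the next level: the minimum is concave, and x^2 is convex with defect t (1 -
   t) (x - y)^2. *)
have cc : t * c1 + (1 - t) * c2 <= c.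
  have : t * Num.min sigma1 s1 + (1 - t) * Num.min sigma2 s2 <= Num.min sg s.
    by rewrite le_min; apply/andP; split; apply: lerD; apply: ler_wpM2l => //;
       rewrite ge_min lexx ?orbT.
  have : 0 <= t * (1 - t) * (x - y) ^+ 2 by apply: mulr_ge0; [exact: mulr_ge0|exact: sqr_ge0].
  have -> : t * (1 - t) * (x - y) ^+ 2 =
      t * x ^+ 2 + (1 - t) * y ^+ 2 - (t * x + (1 - t) * y) ^+ 2 by ring.
  by rewrite /c /c1 /c2; lra.
have c00 : 0 <= t * c1 + (1 - t) * c2 by rewrite addr_ge0// mulr_ge0.
have cge0 : 0 <= c by exact: le_trans cc.
split; first exact: batteryVol_gt0.
apply: le_trans (IH _ _ c10 c20) _.
by rewrite ler_ln ?posrE ?batteryVol_gt0//; exact: batteryVol_homo.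
Qed.

Section growth_rate.
Context {R : realType} (rho : R).
Hypothesis rho_gt0 : 0 < rho.
Local Notation v := (fun sigma => @v R sigma rho).
Local Notation lnW sigma n := (ln (batteryVol sigma rho n sigma)).

Lemma cvg_v sigma : 0 <= sigma -> lnW sigma n / n%:R @[n --> \oo] --> v sigma.
Proof.
move=> sigma0.
have W0 n : 0 < batteryVol sigma rho n sigma by exact: batteryVol_gt0.
suff [l cvgl] : exists l : R, lnW sigma n / n%:R @[n --> \oo] --> l.
  rewrite /Defs.v (_ : v_seq sigma rho = fun n => lnW sigma n / n%:R).
    by have := cvgP _ cvgl.
  by apply/funext => n; rewrite v_seqE.
eexists; apply: (@fekete R _ (ln (2 * Num.sqrt rho))) => [m n|n].
  rewrite -lnM ?posrE// ler_ln ?posrE ?mulr_gt0//.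
  exact: batteryVol_submul.
have r0 : 0 < 2 * Num.sqrt rho by rewrite mulr_gt0// sqrtr_gt0.
rewrite mulr_natl -lnXn// ler_ln ?posrE ?exprn_gt0//.
exact: batteryVol_ge_pow.
Qed.

Lemma is_cvg_v_seq sigma : 0 <= sigma -> cvgn (v_seq sigma rho).
Proof.
move=> sigma0; rewrite (_ : v_seq sigma rho = fun n => lnW sigma n / n%:R).
  by have := cvgP _ (cvg_v _ sigma0).
by apply/funext => n; rewrite v_seqE.
Qed.

Lemma v_le sigma c d : 0 <= sigma -> (forall n, lnW sigma n <= c + n%:R * d) ->
  v sigma <= d.
Proof.
move=> sigma0 Wcd.
have cd : c * n%:R^-1 + d @[n --> \oo] --> d.
  rewrite -[X in _ --> X]add0r; apply: cvgD; last exact: cvg_cst.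
  rewrite -(mulr0 c); apply: cvgM; first exact: cvg_cst.
  apply/gtr0_cvgV0; last exact: cvgr_idn.
  by near=> n; rewrite ltr0n; near: n; exact: nbhs_infty_gt.
apply: ler_cvg_to (cvg_v _ sigma0) cd _.
near=> n.
have n0 : 0 < n%:R :> R by rewrite ltr0n; near: n; exact: nbhs_infty_gt.
by rewrite ler_pdivrMr// mulrDl divfK ?gt_eqF// (mulrC d) Wcd.
Unshelve. all: by end_near. Qed.

(** The limit being known to exist, a bound along the multiples of k suffices. *)
Lemma v_ge sigma k c : 0 <= sigma -> (0 < k)%N ->
  (forall j, j%:R * c <= lnW sigma (j * k)) -> c / k%:R <= v sigma.
Proof.
move=> sigma0 k0 Wc; rewrite leNgt; apply/negP => vc.
have [N _ /(_ (N.+1 * k)%N)] := cvgr_lt _ (cvg_v _ sigma0) _ vc.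
rewrite /= (leq_trans (leqnSn N)) ?leq_pmulr// => /(_ isT).
apply/negP; rewrite -leNgt ler_pdivlMr ?ltr0n ?muln_gt0//.
apply: le_trans (Wc _); rewrite natrM mulrCA divfK//.
by rewrite pnatr_eq0 -lt0n.
Qed.

Lemma v_conv t x y : 0 <= t <= 1 -> 0 <= x -> 0 <= y ->
  t * v x + (1 - t) * v y <= v (t * x + (1 - t) * y).
Proof.
move=> t01 x0 y0; have /andP[t0 t1] := t01.
have xy0 : 0 <= t * x + (1 - t) * y.
  by rewrite addr_ge0// mulr_ge0// subr_ge0.
have cvgl : t * (lnW x n / n%:R) + (1 - t) * (lnW y n / n%:R) @[n --> \oo] -->
    t * v x + (1 - t) * v y.
  by apply: cvgD; apply: cvgM; (exact: cvg_cst || exact: cvg_v).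
apply: ler_cvg_to cvgl (cvg_v _ xy0) _; near=> n.
rewrite !mulrA -mulrDl ler_wpM2r ?invr_ge0//.
exact: batteryVol_log_concave.
Unshelve. all: by end_near. Qed.

Lemma v_concave : concave_function `[0, +oo[ v.
Proof.
move=> t x y; rewrite !inE/= !in_itv/= !andbT => x0 y0.
have t01 : 0 <= t%:num <= 1 by rewrite ge0 le1.
have := v_conv _ _ _ t01 x0 y0.
change (t%:num * v x + (1 - t%:num) * v y <= v (t%:num * x + (1 - t%:num) * y) ->
  - v (t%:num * x + (1 - t%:num) * y) <=
  t%:num * (- v x) + (1 - t%:num) * (- v y)).
lra.
Qed.

Lemma v_ge_ln sigma : 0 <= sigma -> ln (2 * Num.sqrt rho) <= v sigma.
Proof.
move=> sigma0; rewrite -[leLHS]divr1; apply: (v_ge _ 1%N) => // j.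
have r0 : 0 < 2 * Num.sqrt rho by rewrite mulr_gt0// sqrtr_gt0.
rewrite muln1 mulr_natl -lnXn// ler_ln ?posrE ?exprn_gt0 ?batteryVol_gt0//.
exact: batteryVol_ge_pow.
Qed.

Lemma v_le_ln sigma : 0 <= sigma -> v sigma <= ln (2 * Num.sqrt (sigma + rho)).
Proof.
move=> sigma0; apply: (v_le _ 0) => // n; rewrite add0r.
have r0 : 0 < 2 * Num.sqrt (sigma + rho).
  by rewrite mulr_gt0// sqrtr_gt0 ltr_wpDl.
rewrite mulr_natl -lnXn// ler_ln ?posrE ?exprn_gt0 ?batteryVol_gt0//.
exact: batteryVol_le_pow.
Qed.

End growth_rate.

(** * The Gaussian weight *)

Section gaussian.
Context {R : realType} (rho : R).
Hypothesis rho_gt0 : 0 < rho.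
Local Notation mu := (@lebesgue_measure R).

(** The density of the centred normal law of variance [rho] without its normalization; its total
    mass is [peak]. *)
Definition gauss (x : R) : R := expR (- x ^+ 2 / (2 * rho)).
Definition gaussInt (a : R) : R := \int[mu]_(x in `[- a, a]) gauss x.
Local Notation peak := (Num.sqrt (2 * pi * rho)).

Let rho_neq0 : rho != 0. Proof. by rewrite gt_eqF. Qed.

Let peak_gt0 : 0 < peak.
Proof. by rewrite sqrtr_gt0 !mulr_gt0// pi_gt0. Qed.

Let normal_pdfE x : normal_pdf 0 (Num.sqrt rho) x = peak^-1 * gauss x.
Proof.
rewrite /normal_pdf gt_eqF ?sqrtr_gt0// /normal_peak /normal_fun /gauss subr0.
rewrite sqr_sqrtr ?(ltW rho_gt0)// -(mulr_natl rho) -(mulr_natl (rho * pi)).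
by congr ((Num.sqrt _)^-1 * _); ring.
Qed.

Let gaussE : gauss = (fun x => normal_pdf 0 (Num.sqrt rho) x * peak).
Proof.
by apply/funext => x; rewrite normal_pdfE mulrAC mulVf ?gt_eqF// mul1r.
Qed.

Lemma integrable_gauss : mu.-integrable setT (EFin \o gauss).
Proof. by rewrite gaussE; apply: integrable_mulr; exact: integrable_normal_pdf. Qed.

Lemma integrable_gauss_itv (i : interval R) : mu.-integrable [set` i] (EFin \o gauss).
Proof. by apply: (integrableS measurableT) => //; exact: integrable_gauss. Qed.

Lemma Rintegral_gauss : \int[mu]_x gauss x = peak.
Proof.
rewrite gaussE RintegralZr//; last exact: integrable_normal_pdf.
by rewrite /Rintegral integral_normal_pdf mul1r.
Qed.

Let gaussInt_probE (a : R) :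
  (normal_prob 0 (Num.sqrt rho) `[(- a)%R, a] * peak%:E = (gaussInt a)%:E)%E.
Proof.
rewrite /gaussInt /Rintegral fineK; last first.
  by apply: integrable_fin_num => //; exact: integrable_gauss_itv.
rewrite /normal_prob -integralZr//; last first.
  apply: (integrableS measurableT) => //; exact: integrable_normal_pdf.
by apply: eq_integral => x _; rewrite gaussE.
Qed.

Lemma gaussInt_gt0 a : 0 < a -> 0 < gaussInt a.
Proof.
move=> a0; rewrite (@lt_le_trans _ _ (gauss a * (2 * a)))//.
  by rewrite !mulr_gt0// expR_gt0.
rewrite -Rintegral_cst_itv ?(ltW a0)//; apply: le_Rintegral => //.
- exact: integrable_cst_itv.
- exact: integrable_gauss_itv.
move=> x; rewrite /= -sqr_le_itv ?(ltW a0)// => xa.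
rewrite ler_expR ler_pM2r ?invr_gt0; last by rewrite mulr_gt0.
by rewrite lerN2.
Qed.

(** The strip ]a, a + 1] carries positive mass. This strictness is why the supremum of v is not
    attained. *)
Lemma gaussInt_lt a : 0 < a -> gaussInt a < peak.
Proof.
move=> a0.
have E : \int[mu]_(x in `[- a, a + 1]) gauss x - gaussInt a =
    \int[mu]_(x in `]a, a + 1]) gauss x.
  apply: Rintegral_itvB; rewrite ?bnd_simp; [exact: integrable_gauss_itv|lra|lra].
have tot : \int[mu]_(x in `[- a, a + 1]) gauss x <= peak.
  rewrite -Rintegral_gauss; apply: ge_Rintegral_subset => //.
  - exact: integrable_gauss.
  - exact: integrable_gauss_itv.
  - by move=> x; exact: expR_ge0.
have : 0 < \int[mu]_(x in `]a, a + 1]) gauss x.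
  rewrite (@lt_le_trans _ _ (\int[mu]_(x in `]a, a + 1]) gauss (a + 1)))//.
    rewrite Rintegral_cst//= lebesgue_measure_itv/= lte_fin ltrDl ltr01/=.
    by rewrite addrAC subrr add0r mulr1 expR_gt0.
  apply: le_Rintegral => //.
  - apply: measurable_bounded_integrable => //; last exact: bounded_cst.
    by rewrite /= lebesgue_measure_itv/=; case: ifPn => // _; rewrite -EFinB ltry.
  - exact: integrable_gauss_itv.
  move=> x; rewrite /= in_itv/= => /andP[ax xa].
  rewrite ler_expR ler_pM2r ?invr_gt0; last by rewrite mulr_gt0.
  by rewrite lerN2 ler_sqr// nnegrE; lra.
lra.
Qed.

(** Continuity from below of the normal law along the intervals [-n, n]. *)
Lemma gaussInt_near (B : R) : B < peak ->
  exists A, forall a, A <= a -> B < gaussInt a.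
Proof.
move=> Bp; pose F n : set (measurableTypeR R) := `[- n%:R, n%:R]%classic.
have FT : \bigcup_n F n = setT.
  apply/seteqP; split=> // x _; exists (Num.truncn `|x|).+1 => //.
  by rewrite /F/= in_itv/= -ler_norml ltW// truncnS_gt.
pose P := normal_prob 0 (Num.sqrt rho) : probability _ R.
have cvgF : P (F n) @[n --> \oo] --> P (\bigcup_n F n).
  apply: nondecreasing_cvg_mu; rewrite ?FT//.
    by move=> n; exact: measurable_itv.
  move=> m n mn; apply/subsetPset => x; rewrite /F/= !in_itv/= -!ler_norml.
  by move=> /le_trans; apply; rewrite ler_nat.
move: cvgF; rewrite FT probability_setT => /fine_cvgP[_ cvgF].
have Bp1 : B / peak < 1 by rewrite ltr_pdivrMr// mul1r.
have [N _ /(_ N (leqnn N))] := cvgr_gt _ cvgF _ Bp1.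
rewrite /= ltr_pdivrMr// => BN; exists N%:R => a Na.
have -> : gaussInt a = fine (gaussInt a)%:E by [].
rewrite -gaussInt_probE fineM// ?fin_num_measure//.
rewrite (lt_le_trans BN)//= ler_pM2r// fine_le ?fin_num_measure//.
  exact: measurable_itv.
apply: (le_measure P); rewrite ?inE//; first exact: measurable_itv.
by move=> x; rewrite /F/= !in_itv/=; lra.
Qed.

Lemma is_derive_gauss (c x : R) :
  is_derive x (1 : R) (fun x : R => (c * x + rho * x ^+ 3) * gauss x)
    ((c + 3 * rho * x ^+ 2 - (c + rho * x ^+ 2) * x ^+ 2 / rho) * gauss x).
Proof.
have De : is_derive x (1 : R) gauss (gauss x * (- x / rho)).
  have h : is_derive x (1 : R) (fun x : R => - x ^+ 2 / (2 * rho)) (- x / rho).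
    apply: is_derive_eq; rewrite /GRing.scale/=; field.
    exact rho_neq0.
  exact: (@is_derive1_comp _ expR (fun x : R => - x ^+ 2 / (2 * rho))).
apply: is_derive_eq; rewrite /GRing.scale/=; field.
exact rho_neq0.
Qed.

End gaussian.

Section gaussian_bounds.
Context {R : realType} (sigma rho : R).
Hypotheses (sigma_ge0 : 0 <= sigma) (rho_gt0 : 0 < rho).
Local Notation mu := (@lebesgue_measure R).
Local Notation W := (batteryVol sigma rho).
Local Notation amax := (Num.sqrt (sigma + rho)).

Let rho_neq0 : rho != 0. Proof. by rewrite gt_eqF. Qed.

Let amax_gt0 : 0 < amax. Proof. by rewrite sqrtr_gt0 ltr_wpDl. Qed.

Let expR_shift (s c x : R) :
  expR ((s + rho - x ^+ 2 + c) / (2 * rho)) =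
  expR ((s + (rho + c)) / (2 * rho)) * gauss rho x.
Proof. by rewrite -expRD; congr expR; field; exact rho_neq0. Qed.

(** Start from 1 <= exp(s / (2 rho)) for s >= 0. Each step contributes exp(rho / (2 rho)) and the
    Gaussian mass of the admissible range of x. *)
Lemma batteryVol_le_gauss n s :
  W n s <= gaussInt rho amax ^+ n * expR ((s + n%:R * rho) / (2 * rho)).
Proof.
have Z0 := ltW (gaussInt_gt0 _ rho_gt0 _ amax_gt0).
elim: n s => [|n IH] s; have [s0|s0] := ltP s 0;
  try by rewrite batteryVol_neg// mulr_ge0 ?expR_ge0// exprn_ge0.
  rewrite /= s0 expr0 !mul1r mul0r addr0 -expR0 ler_expR divr_ge0// mulr_ge0//.
  exact: ltW.
rewrite batteryVolS// exprSr -mulrA (mulrC (gaussInt _ _)) mulrA.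
rewrite -RintegralZl//; last exact: integrable_gauss_itv.
apply: le_Rintegral_subset => //.
- exact: batteryVol_integrable.
- by apply: integrable_mull => //; exact: integrable_gauss_itv.
- move=> x _; apply: le_trans (IH _) _.
  have -> : s + n.+1%:R * rho = s + (rho + n%:R * rho) by rewrite -natr1; ring.
  rewrite -mulrA -expR_shift.
  apply: ler_wpM2l; first exact: exprn_ge0.
  rewrite ler_expR ler_pM2r ?invr_gt0 ?mulr_gt0//.
  by rewrite !lerD2r ge_min lexx orbT.
- by move=> x /negP xa; rewrite batteryVol_support.
Qed.

Let continuous_gauss_poly (p : R -> R) : (forall x : R, derivable p x 1) ->
  {within `[- amax, amax], continuous (fun x => p x * gauss rho x)}.
Proof.
move=> dp; apply: continuous_subspaceT => x.
apply: differentiable_continuous; apply/derivable1_diffP.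
exact: derivableM.
Qed.

(* The difference of the two sides is the integral of the derivative of the odd
   function F below, so no Gaussian moment is needed. *)
Lemma Rintegral_gauss_parabola s d : 0 <= s <= sigma ->
  (s * (sigma - s) - 2 * rho ^+ 2 - d) * gaussInt rho amax <=
  \int[mu]_(x in `[- amax, amax])
    (((s + rho - x ^+ 2) * (sigma - (s + rho - x ^+ 2)) - d) * gauss rho x).
Proof.
move=> /andP[s0 ss].
(* Chosen to match the constant term of the integrand difference; the coefficient [rho] of x^3 in F
   matches its term - x^4. *)
pose c := (sigma - 2 * s) * rho + rho ^+ 2.
pose F (x : R) := (c * x + rho * x ^+ 3) * gauss rho x.
pose f (x : R) := (c + 3 * rho * x ^+ 2 - (c + rho * x ^+ 2) * x ^+ 2 / rho) * gauss rho x.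
have dF (x : R) : is_derive x (1 : R) F (f x) by exact: is_derive_gauss.
have F_cont : continuous F.
  by move=> x; apply: differentiable_continuous; apply/derivable1_diffP; exact: ex_derive.
have f_cont : {within `[- amax, amax], continuous f}.
  by apply: continuous_gauss_poly => x; exact: ex_derive.
have ftc : \int[mu]_(x in `[- amax, amax]) f x = F amax - F (- amax).
  rewrite /Rintegral (@continuous_FTC2 _ f F)//.
  - by have := amax_gt0; lra.
  - split; first by move=> x _; exact: ex_derive.
      by apply: cvg_at_right_filter; exact: F_cont.
    by apply: cvg_at_left_filter; exact: F_cont.
  - by move=> x _; rewrite derive1E derive_val.
have intf : mu.-integrable `[- amax, amax] (EFin \o f).
  by apply: continuous_compact_integrable => //; exact: segment_compact.
(* Truncation at [amax] leaves a boundary term, nonnegative since [s <= sigma]. *)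
have F0 : 0 <= F amax - F (- amax).
  have -> : F amax - F (- amax) =
      2 * amax * gauss rho amax * (c + rho * amax ^+ 2).
    by rewrite /F /gauss sqrrN; ring.
  rewrite mulr_ge0 ?mulr_ge0 ?expR_ge0 ?(ltW amax_gt0)//.
  rewrite sqr_sqrtr ?(addr_ge0 sigma_ge0 (ltW rho_gt0))//.
  have -> : c + rho * (sigma + rho) = 2 * (sigma - s) * rho + 2 * rho ^+ 2.
    by rewrite /c; ring.
  by rewrite addr_ge0 ?mulr_ge0 ?subr_ge0 ?sqr_ge0 ?(ltW rho_gt0).
rewrite -RintegralZl//; last exact: integrable_gauss_itv.
rewrite -subr_ge0 -RintegralB//; first last.
- by apply: integrable_mull => //; exact: integrable_gauss_itv.
- apply: continuous_compact_integrable; first exact: segment_compact.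
  by apply: continuous_gauss_poly => x; exact: ex_derive.
rewrite (@eq_Rintegral _ _ _ mu _ f) ?ftc// => x _.
by rewrite /f /c; field; exact rho_neq0.
Qed.

(* Under the Gaussian weight of variance rho the level s moves as a martingale with
   increments of variance 2 rho^2, so s (sigma - s) loses at most 2 rho^2 per step
   on average; being nonpositive off [0, sigma], it accounts for the killing at 0
   and for the saturation at sigma. *)
Lemma batteryVol_parabola n s :
  gaussInt rho amax ^+ n * expR ((s + n%:R * rho - sigma) / (2 * rho)) *
    (s * (sigma - s) - n%:R * (2 * rho ^+ 2)) <= sigma ^+ 2 / 4 * W n s.
Proof.
have Z0 := ltW (gaussInt_gt0 _ rho_gt0 _ amax_gt0).
have sg4 : 0 <= sigma ^+ 2 / 4 by rewrite divr_ge0// sqr_ge0.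
have c0 m : 0 <= m%:R * (2 * rho ^+ 2) by rewrite mulr_ge0// mulr_ge0// sqr_ge0.
have outside m t : ~~ (0 <= t <= sigma) ->
    gaussInt rho amax ^+ m * expR ((t + m%:R * rho - sigma) / (2 * rho)) *
    (t * (sigma - t) - m%:R * (2 * rho ^+ 2)) <= sigma ^+ 2 / 4 * W m t.
  move=> ts; apply: (@le_trans _ _ 0); last by rewrite mulr_ge0 ?batteryVol_ge0.
  apply: mulr_ge0_le0; first by rewrite mulr_ge0 ?expR_ge0 ?exprn_ge0.
  rewrite subr_le0 (le_trans _ (c0 _))//.
  have [t0|t0] := leP 0 t; last by apply: mulr_le0_ge0; have := sigma_ge0; lra.
  by move: ts; rewrite t0/= -ltNge => ?; apply: mulr_ge0_le0; lra.
elim: n s => [|n IH] s; have [ss|] := boolP (0 <= s <= sigma); try exact: outside.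
  have /andP[s0 s1] := ss.
  rewrite /= s0 expr0 !mul1r !mul0r addr0 subr0 mulr1.
  have e1 : expR ((s - sigma) / (2 * rho)) <= 1.
    by rewrite -expR0 ler_expR ler_pdivrMr ?mulr_gt0// mul0r subr_le0.
  rewrite (@le_trans _ _ (1 * (s * (sigma - s))))//.
    by apply: ler_wpM2r => //; rewrite mulr_ge0// subr_ge0.
  (* The factor sigma^2 / 4 is the maximum of the parabola. *)
  rewrite mul1r -subr_ge0.
  have -> : sigma ^+ 2 / 4 - s * (sigma - s) = (s - sigma / 2) ^+ 2 by field.
  exact: sqr_ge0.
have /andP[s0 s1] := ss.
rewrite batteryVolS// min_r// -RintegralZl//; last first.
  by have := batteryVol_integrable sigma rho sigma_ge0 rho_gt0 n s; rewrite min_r.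
pose K := gaussInt rho amax ^+ n * 
  expR ((s + (rho + (n%:R * rho - sigma))) / (2 * rho)).
have sE : s + n.+1%:R * rho - sigma = s + (rho + (n%:R * rho - sigma)).
  by rewrite -natr1; ring.
have K0 : 0 <= K by rewrite mulr_ge0 ?expR_ge0 ?exprn_ge0.
have := Rintegral_gauss_parabola s (n%:R * (2 * rho ^+ 2)) ss.
move=> /(ler_wpM2l K0) parab.
rewrite sE.
have -> : gaussInt rho amax ^+ n.+1 *
    expR ((s + (rho + (n%:R * rho - sigma))) / (2 * rho)) *
    (s * (sigma - s) - n.+1%:R * (2 * rho ^+ 2)) =
    K * ((s * (sigma - s) - 2 * rho ^+ 2 - n%:R * (2 * rho ^+ 2)) *
      gaussInt rho amax).
  rewrite /K; set e := expR _; set Z := gaussInt _ _.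
  by rewrite -natr1 exprSr; ring.
apply: le_trans parab _.
have intp : mu.-integrable `[- amax, amax] (EFin \o (fun x =>
    ((s + rho - x ^+ 2) * (sigma - (s + rho - x ^+ 2)) - n%:R * (2 * rho ^+ 2)) *
    gauss rho x)).
  apply: continuous_compact_integrable; first exact: segment_compact.
  by apply: continuous_gauss_poly => x; exact: ex_derive.
rewrite -RintegralZl//; apply: ge_Rintegral_subset => //.
- apply: integrable_mull => //.
  by have := batteryVol_integrable sigma rho sigma_ge0 rho_gt0 n s; rewrite min_r.
- exact: integrable_mull.
(* [IH] holds at every real level, including those outside [0, sigma]. *)
- move=> x _; apply: le_trans (IH _).
  have := expR_shift s (n%:R * rho - sigma) x; rewrite addrA => ->.
  rewrite /K; set e := expR _; set g := gauss _ _; set Z := gaussInt _ _ ^+ _.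
  by rewrite le_eqVlt; apply/orP; left; apply/eqP; ring.
- by move=> x; rewrite mulr_ge0 ?batteryVol_ge0.
Qed.

End gaussian_bounds.

(** * Range, strict monotonicity and continuity *)

Section range_of_v.
Context {R : realType} (rho : R).
Hypothesis rho_gt0 : 0 < rho.
Local Notation v := (fun sigma => @v R sigma rho).
Local Notation W sigma := (batteryVol sigma rho).
Local Notation peak := (Num.sqrt (2 * pi * rho)).
Local Notation vsup := (2^-1 * ln (2 * pi * expR 1 * rho)).

Let peak_gt0 : 0 < peak.
Proof. by rewrite sqrtr_gt0 !mulr_gt0// pi_gt0. Qed.

(** The form met in the Gaussian bounds: log of the total mass, plus rho / (2 rho) per step. *)
Lemma vsupE : vsup = ln peak + 2^-1.
Proof.
have p0 : 0 < 2 * pi * rho by rewrite !mulr_gt0// pi_gt0.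
have -> : ln peak = 2^-1 * ln (2 * pi * rho).
  by rewrite -[in RHS](sqr_sqrtr (ltW p0)) lnXn// -(mulr_natl (ln _)) mulrA mulVf// mul1r.
rewrite (_ : _ * rho = 2 * pi * rho * expR 1); last ring.
by rewrite lnM ?posrE ?expR_gt0// expRK mulrDr mulr1.
Qed.

Lemma v_lt_vsup sigma : 0 <= sigma -> v sigma < vsup.
Proof.
move=> sigma0; pose Z := gaussInt rho (Num.sqrt (sigma + rho)).
have amax0 : 0 < Num.sqrt (sigma + rho) by rewrite sqrtr_gt0 ltr_wpDl.
have Z0 : 0 < Z by exact: gaussInt_gt0.
rewrite vsupE; apply: (@le_lt_trans _ _ (ln Z + 2^-1)); last first.
  by rewrite ltrD2r ltr_ln ?posrE//; exact: gaussInt_lt.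
(* The constant is the exponent due to the initial level; it vanishes in the rate. *)
apply: (v_le _ rho_gt0 _ (sigma / (2 * rho))) => // n.
have W0 : 0 < W sigma n sigma by exact: batteryVol_gt0.
have := batteryVol_le_gauss sigma rho sigma0 rho_gt0 n sigma.
rewrite -ler_ln ?posrE ?mulr_gt0 ?exprn_gt0 ?expR_gt0//.
rewrite lnM ?posrE ?exprn_gt0 ?expR_gt0// lnXn// expRK -(mulr_natl (ln _)).
move=> /le_trans; apply; rewrite le_eqVlt; apply/orP; left; apply/eqP.
by field; rewrite gt_eqF.
Qed.

(** From level 0, m steps refill the battery and n steps use it; the level is then at least 0 and
    the cycle repeats. *)
Lemma v_ge_cycle sigma m n : 0 <= sigma -> sigma <= m%:R * (rho / 2) ->
  (0 < m + n)%N ->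
  (m%:R * ln (2 * Num.sqrt (rho / 2)) + ln (W sigma n sigma)) / (m + n)%:R
    <= v sigma.
Proof.
move=> sigma0 sm mn0; apply: v_ge => // j.
have c0 : 0 < 2 * Num.sqrt (rho / 2) by rewrite mulr_gt0// sqrtr_gt0 divr_gt0.
have W0 : 0 < W sigma n sigma by exact: batteryVol_gt0.
have K0 : 0 < (2 * Num.sqrt (rho / 2)) ^+ m * W sigma n sigma.
  by rewrite mulr_gt0// exprn_gt0.
have cycle i : ((2 * Num.sqrt (rho / 2)) ^+ m * W sigma n sigma) ^+ i <=
    W sigma (i * (m + n)) 0.
  elim: i => [|i IH]; first by rewrite /= lexx mul1r.
  rewrite mulSn -addnA; apply: le_trans (batteryVol_recharge _ _ _ _ _ _ _ _) => //.
  rewrite add0r min_l// exprS -mulrA; apply: ler_wpM2l.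
    by rewrite exprn_ge0// ltW.
  apply: le_trans (batteryVol_supmul _ _ _ _ _ _ _) => //.
  by rewrite ler_wpM2l// ltW.
rewrite [m%:R * _]mulr_natl -lnXn// -lnM ?posrE ?exprn_gt0// mulr_natl -lnXn//.
rewrite ler_ln ?posrE ?exprn_gt0 ?batteryVol_gt0//.
by apply: le_trans (cycle j) _; exact: batteryVol_le_cap.
Qed.

(* A battery of capacity sigma = 4 rho q, started half full, lasts n = q^2 steps
   with probability at least 1/2 under independent Gaussian withdrawals of
   variance rho, and 8 q steps suffice to recharge it. *)
Lemma v_ge_gauss q sigma : (0 < q)%N -> sigma = 4 * rho * q%:R ->
  ((8 * q)%:R * ln (2 * Num.sqrt (rho / 2)) +
   ((q ^ 2)%:R * (ln (gaussInt rho (Num.sqrt (sigma + rho))) + 2^-1)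
     - q%:R - ln 2)) / (8 * q + q ^ 2)%:R <= v sigma.
Proof.
move=> q0 sigmaE; have qR0 : 0 < q%:R :> R by rewrite ltr0n.
have sigma0 : 0 <= sigma by rewrite sigmaE !mulr_ge0// ltW.
have s2 : 0 <= sigma / 2 by rewrite divr_ge0.
apply: le_trans (v_ge_cycle sigma (8 * q) (q ^ 2) _ _ _) => //; last 2 first.
- by rewrite natrM sigmaE; lra.
- by rewrite addn_gt0 muln_gt0 q0.
rewrite ler_wpM2r ?invr_ge0// lerD2l.
set Z := gaussInt _ _.
have Z0 : 0 < Z by apply: gaussInt_gt0 => //; rewrite sqrtr_gt0 ltr_wpDl.
have := batteryVol_parabola sigma rho sigma0 rho_gt0 (q ^ 2) (sigma / 2).
rewrite -/Z.
(* Over q^2 steps the parabola loses 2 rho^2 q^2 = sigma^2 / 8, half of its initial value. *)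
have -> : sigma / 2 * (sigma - sigma / 2) - (q ^ 2)%:R * (2 * rho ^+ 2) =
    sigma ^+ 2 / 4 * 2^-1.
  by rewrite sigmaE natrX; field.
have -> : (sigma / 2 + (q ^ 2)%:R * rho - sigma) / (2 * rho) =
    (q ^ 2)%:R * 2^-1 - q%:R.
  by rewrite sigmaE natrX; field; rewrite gt_eqF.
have sg4 : 0 < sigma ^+ 2 / 4.
  by rewrite divr_gt0// exprn_gt0// sigmaE !mulr_gt0.
rewrite mulrCA ler_pM2l// => parab.
have : Z ^+ (q ^ 2) * expR ((q ^ 2)%:R * 2^-1 - q%:R) / 2 <=
    W sigma (q ^ 2) sigma.
  by apply: le_trans parab _; exact: batteryVol_le_cap.
rewrite -ler_ln ?posrE ?batteryVol_gt0 ?mulr_gt0 ?exprn_gt0 ?expR_gt0 ?invr_gt0//.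
apply: le_trans; rewrite ln_div ?posrE ?mulr_gt0 ?exprn_gt0 ?expR_gt0//.
rewrite lnM ?posrE ?exprn_gt0 ?expR_gt0// lnXn// expRK -(mulr_natl (ln _)).
lra.
Qed.

(** In [v_ge_gauss] the recharge and the losses are linear in q against a main term of order q^2,
    whose coefficient tends to [vsup] as the truncation recedes. *)
Lemma v_near_vsup B s : B < vsup -> exists2 u, s < u & B < v u.
Proof.
move=> Bsup; pose d := (vsup - B) / 2.
(* One half [d] of the gap pays for the truncation, the other for the terms linear in q. *)
have d0 : 0 < d by rewrite divr_gt0// subr_gt0.
have Bp : expR (B + d - 2^-1) < peak.
  rewrite -[ltRHS]lnK ?posrE// ltr_expR.
  by move: Bsup; rewrite /d vsupE; lra.
have [A HA] := gaussInt_near _ rho_gt0 _ Bp.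
pose lc := ln (2 * Num.sqrt (rho / 2)).
(* The three terms ensure u > s, a truncation beyond A, and d q^2 above the linear terms; the 2
   covers q + ln 2 <= 2 q. *)
pose M := `|s| / rho + A ^+ 2 / rho + (8 * `|lc| + 8 * `|B| + 2) / d.
pose q := (Num.truncn M).+1; have Mq : M < q%:R by exact: truncnS_gt.
have [sq Aq lq] : [/\ `|s| < rho * q%:R, A ^+ 2 < rho * q%:R &
    8 * `|lc| + 8 * `|B| + 2 < d * q%:R].
  have [x0 y0 z0] : [/\ 0 <= `|s| / rho, 0 <= A ^+ 2 / rho &
      0 <= (8 * `|lc| + 8 * `|B| + 2) / d].
    by split; apply: divr_ge0; rewrite ?sqr_ge0 ?(ltW rho_gt0) ?(ltW d0).
  split; rewrite [ltRHS]mulrC -ltr_pdivrMr//; apply: le_lt_trans Mq;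
    rewrite /M; lra.
have q1 : 1 <= q%:R :> R by rewrite ler1n.
have rq0 : 0 < rho * q%:R by rewrite mulr_gt0// ltr0n.
exists (4 * rho * q%:R).
  by have := ler_norm s; lra.
apply: lt_le_trans (v_ge_gauss q _ _ erefl) => //.
set Z := gaussInt _ _.
have ZB : B + d < ln Z + 2^-1.
  have : expR (B + d - 2^-1) < Z.
    apply: HA; apply: le_trans (ler_norm A) _; rewrite -sqrtr_sqr.
    by apply: ler_wsqrtr; have := rho_gt0; lra.
  move=> BZ; have Z0 : 0 < Z by apply: lt_trans BZ; exact: expR_gt0.
  by move: BZ; rewrite -[ltRHS]lnK ?posrE// ltr_expR; lra.
rewrite -/lc ltr_pdivlMr ?ltr0n ?addn_gt0//.
have ln2 : ln 2 <= 1 :> R.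
  by have := @le_ln1Dx R 1; rewrite (_ : 1 + 1 = 2)//; apply; lra.
rewrite natrD natrX natrM.
have h1 : q%:R ^+ 2 * (B + d) <= q%:R ^+ 2 * (ln Z + 2^-1).
  by rewrite ler_wpM2l ?sqr_ge0// ltW.
have h2 : q%:R * (8 * `|lc| + 8 * `|B| + 2) < q%:R * (d * q%:R).
  by rewrite ltr_pM2l// ltr0n.
have h3 : q%:R * - `|lc| <= q%:R * lc by rewrite ler_pM2l ?ltr0n// lerNl -normrN ler_norm.
have h4 : q%:R * B <= q%:R * `|B| by rewrite ler_pM2l ?ltr0n// ler_norm.
move: h1 h2 h3 h4 q1 ln2.
move: (ln 2) (ln Z) `|lc| (lc) `|B| (d) (q%:R : R) => l2 lz nlc l nB e x; lra.
Qed.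

(** If v t <= v s with s < t, concavity keeps v at most v t beyond t, whereas v t < [vsup] gives
    some u > t with v u > v t. *)
Lemma v_incr : {in `[0, +oo[ &, {homo v : s t / s < t}}.
Proof.
move=> s t; rewrite !in_itv/= !andbT => s0 t0 st; rewrite ltNge; apply/negP => vts.
have [u tu vtu] := v_near_vsup _ t (v_lt_vsup _ t0).
have us0 : 0 < u - s by lra.
pose k := (u - t) / (u - s).
have k1 : 0 <= k <= 1.
  rewrite divr_ge0 ?subr_ge0 ?(ltW tu)// ?(ltW (lt_trans st tu))//=.
  by rewrite ler_pdivrMr// mul1r; lra.
have := v_conv _ rho_gt0 k s u k1 s0 (le_trans t0 (ltW tu)).
have -> : k * s + (1 - k) * u = t by rewrite /k; field; lra.
have : 0 < (1 - k) * (v u - v t).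
  rewrite mulr_gt0 ?subr_gt0// ltr_pdivrMr// mul1r; lra.
have : 0 <= k * (v s - v t) by rewrite mulr_ge0 ?subr_ge0//; case/andP: k1.
lra.
Qed.

Lemma v0 : v 0 = ln (2 * Num.sqrt rho).
Proof.
apply/eqP; rewrite eq_le v_ge_ln// andbT.
by have := v_le_ln _ rho_gt0 0 (lexx _); rewrite add0r.
Qed.

(* Concavity bounds the slope of v on [s, t] by the slope of the chord from 0 to
   s, and so by that from (0, v 0) to (r, vsup). *)
Let v_lipschitz r s t : 0 < r -> r <= s -> s <= t ->
  0 <= v t - v s <= (t - s) * ((vsup - v 0) / r).
Proof.
move=> r0 rs st; have s0 : 0 < s := lt_le_trans r0 rs.
have t0 : 0 < t := lt_le_trans s0 st.
have vst : v s <= v t.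
  move: st; rewrite le_eqVlt => /predU1P[->//|st].
  by apply/ltW/v_incr => //; rewrite in_itv/= andbT ltW.
rewrite subr_ge0 vst/=.
have vsup0 : 0 <= vsup - v 0 by rewrite subr_ge0 ltW// v_lt_vsup.
apply: (@le_trans _ _ ((t - s) * ((vsup - v 0) / s))); last first.
  apply: ler_wpM2l; first by rewrite subr_ge0.
  by apply: ler_wpM2l => //; rewrite lef_pV2 ?posrE.
rewrite mulrA ler_pdivlMr//.
have k1 : 0 <= 1 - s / t <= 1.
  by rewrite subr_ge0 ler_pdivrMr// mul1r st/= gerBl divr_ge0// ltW.
have := v_conv _ rho_gt0 _ _ _ k1 (lexx 0) (ltW t0).
rewrite mulr0 add0r opprB addrCA subrr addr0 divfK ?gt_eqF// => /(ler_wpM2l (ltW t0)).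
have -> : t * ((1 - s / t) * v 0 + s / t * v t) = (t - s) * v 0 + s * v t.
  by field; rewrite gt_eqF.
have vs : v s <= vsup by rewrite ltW// v_lt_vsup// ltW.
have : (t - s) * v s <= (t - s) * vsup by rewrite ler_wpM2l// subr_ge0.
lra.
Qed.

Lemma v_continuous : {within `[0, +oo[%classic, continuous v}.
Proof.
apply/subspace_continuousP => s /=; rewrite in_itv/= andbT.
rewrite le_eqVlt => /predU1P[<-|s0].
  (* The Lipschitz constant blows up at 0; there v is squeezed between v 0 and ln(2 sqrt(x +
     rho)). *)
  have cvg_ub : ln (2 * Num.sqrt (x + rho)) @[x --> 0] --> v 0.
    rewrite v0 -[in X in _ --> X](add0r rho).
    apply: continuous_cvg.
      by apply: continuous_ln; rewrite add0r mulr_gt0// sqrtr_gt0.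
    apply: cvgM; first exact: cvg_cst.
    apply: continuous_cvg; first exact: sqrt_continuous.
    by apply: cvgD; [exact: cvg_id|exact: cvg_cst].
  apply: (@squeeze_cvgr _ _ _ _ (cst (v 0)) (fun x : R => ln (2 * Num.sqrt (x + rho)))).
  - near=> x; have x0 : 0 <= x.
      have : `[0, +oo[%classic x by near: x; exact: withinT.
      by rewrite /= in_itv/= andbT.
    by rewrite /= v0 v_ge_ln//= v_le_ln.
  - exact: cvg_cst.
  - exact: cvg_within_filter.
apply: cvg_within_filter; apply/cvgrPdist_le => e e0.
(* The Lipschitz constant of v on [s / 2, +oo[, which contains the x near s. *)
pose C := (vsup - v 0) / (s / 2).
have s20 : 0 < s / 2 by rewrite divr_gt0.
have C0 : 0 <= C by rewrite divr_ge0 ?(ltW s20)// subr_ge0 ltW// v_lt_vsup.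
have eC : 0 < e / (C + 1) by rewrite divr_gt0// ltr_wpDl.
have near_s k : 0 < k -> \forall x \near s, `|s - x| < k.
  by move=> k0; have /cvgrPdist_lt := @cvg_id _ (nbhs s); exact.
near=> x.
have xs : `|s - x| < s / 2 by near: x; exact: near_s.
have xe : `|s - x| <= e / (C + 1) by apply: ltW; near: x; exact: near_s.
have xeC : `|s - x| * C <= e.
  move: xe; rewrite ler_pdivlMr ?ltr_wpDl//; apply: le_trans.
  by rewrite ler_wpM2l// lerDl.
apply: le_trans xeC; move: xs; rewrite ltr_norml => /andP[xs1 xs2].
have [xs|/ltW xs] := leP s x.
  have /andP[v1 v2] := v_lipschitz (s / 2) s x s20 ltac:(lra) xs.
  by rewrite distrC ger0_norm// distrC ger0_norm ?subr_ge0.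
have /andP[v1 v2] := v_lipschitz (s / 2) x s s20 ltac:(lra) xs.
by rewrite !ger0_norm ?subr_ge0// -subr_ge0.
Unshelve. all: by end_near. Qed.

End range_of_v.

Theorem theorem4p1 (R : realType) (rho : R) (rho_gt0 : 0 < rho) :
  [/\ forall sigma : R, 0 <= sigma -> cvgn (v_seq sigma rho),
      {in `[0, +oo[ &, {homo (fun sigma => v sigma rho) : s t / s < t}},
      {within `[0, +oo[%classic, continuous (fun sigma => v sigma rho)},
      concave_function `[0, +oo[%classic (fun sigma => v sigma rho) &
      (fun sigma => v sigma rho) @` `[0, +oo[%classic =
        `[ln (2 * Num.sqrt rho), 2^-1 * ln (2 * pi * expR 1 * rho)[%classic ].
Proof.
split.
- by move=> sigma sigma0; exact: is_cvg_v_seq.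
- exact: v_incr.
- exact: v_continuous.
- exact: v_concave.
apply/seteqP; split=> [_ [s + <-]|y] /=; rewrite !in_itv/=.
  by rewrite in_itv/= andbT => s0; apply/andP; split; [exact: v_ge_ln|exact: v_lt_vsup].
(* Some v u with u > 0 exceeds y, so the intermediate value theorem on [0, u] reaches y. *)
move=> /andP[y0 ysup]; have [u u0 yu] := v_near_vsup rho rho_gt0 _ 0 ysup.
have vu : {within `[0, u], continuous (fun sigma => v sigma rho)}.
  apply: continuous_subspaceW (v_continuous rho rho_gt0).
  by move=> x /=; rewrite !in_itv/= => /andP[->].
have y0u : Num.min (v 0 rho) (v u rho) <= y <= Num.max (v 0 rho) (v u rho).
  by rewrite ge_min le_max v0// y0 (ltW yu) orbT.
have [c c0 <-] := IVT (ltW u0) vu y0u.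
by exists c => //; move: c0; rewrite !in_itv/= andbT => /andP[].
Qed.
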